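(* Fix a positive integer $t$. Consider MRHS systems over $GF(q)$ $$A_iX\in\{b_{i_1},\ldots,b_{i_{s_i}}\},\qquad i=1,\ldots,m,$$ in a column $n$-vector $X$ of unknowns, where the matrices $A_i$ over $GF(q)$, of size $t_i\times n$ and rank $t_i$, are fixed, and the right-hand side sets are generated according to the probabilistic model described in the context. Suppose that $t_i\le t$ for all $i$ and that $n$ tends to infinity. Then the average complexity of solving the system is $$O\bigl(m\,q^{\,n-\lceil n/t\rceil}\bigr).$$
   Context: An MRHS (Multiple Right-Hand Sides) system over $GF(q)$ is a system of inclusions $A_iX\in S_i$, $i=1,\dots,m$, where $X$ is a column $n$-vector of unknowns over $GF(q)$, $A_i$ is a $t_i\times n$ matrix over $GF(q)$ of rank $t_i$, and $S_i=\{b_{i_1},\ldots,b_{i_{s_i}}\}$ is a set of column vectors in $GF(q)^{t_i}$. A solution is a vector $X_0$ satisfying all the inclusions. Probabilistic model: the matrices $A_i$ are fixed. For $i=1,\dots,m$, independently, a polynomial $g_i(y_1,\dots,y_{t_i})$ is chosen uniformly at random from all polynomials over $GF(q)$ of degree at most $q-1$ in each variable, and $S_i$ is the set of zeros of $g_i$ in $GF(q)^{t_i}$. Gluing: given two equations $A_1X\in S_1$ and $A_2X\in S_2$, gluing replaces them by one equation $AX\in S$ having as solutions exactly their common solutions. The matrix $A$ is obtained by writing $A_2$ under $A_1$ and eliminating dependent rows (so $A$ has $\mathrm{rank}(A_1,A_2)$ rows, where $\mathrm{rank}(A_1,A_2)$ is the rank of the set of all rows of $A_1$ and $A_2$), and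 $S$ is the set of vectors $b$ such that the linear system $AX=b$ is equivalent to $A_1X=b_1,\ A_2X=b_2$ for some $b_1\in S_1$, $b_2\in S_2$. Average complexity: the system is solved by successively gluing equations $1,2,\dots,m$ into a single equation. Let $S^{(k)}$ be the right-hand side set of the equation obtained by gluing the first $k$ equations (with $S^{(1)}=S_1$). The average complexity is measured, up to a constant factor, by the sum of the average numbers of right-hand sides, $\sum_{k=1}^m \mathbb{E}|S^{(k)}|$. The cost of solving the final equation $AX\in S$ as $|S|$ ordinary linear systems is neglected. *)

(* Defs.v *)
From HB Require Import structures.
From mathcomp Require Import all_boot all_order all_algebra.
From mathcomp Require Export mpoly.

Set Implicit Arguments.
Unset Strict Implicit.
Unset Printing Implicit Defensive.

Import Order.TTheory GRing.Theory Num.Theory.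

Local Open Scope ring_scope.

(* GF(q) is an arbitrary [F : finFieldType], with q = #|F|. *)

Definition reduced (F : finFieldType) (t : nat) (p : {mpoly F[t]}) : bool :=
  all (fun e : 'X_{1..t} => [forall i, (e i <= #|F|.-1)%N]) (msupp p).

Record redpoly (F : finFieldType) (t : nat) : predArgType :=
  RedPoly { redpoly_val :> {mpoly F[t]}; _ : reduced redpoly_val }.

HB.instance Definition _ (F : finFieldType) (t : nat) :=
  [isSub for @redpoly_val F t].
HB.instance Definition _ (F : finFieldType) (t : nat) :=
  [Choice of redpoly F t by <:].

(* Finiteness of [redpoly F t], by encoding a polynomial as its table of
   coefficients. *)
Definition redpoly_coefs (F : finFieldType) (t : nat) (p : redpoly F t) :
    {ffun {ffun 'I_t -> 'I_#|F|.-1.+1} -> F} :=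
  [ffun e : {ffun 'I_t -> 'I_#|F|.-1.+1} => p@_[multinom (e i : nat) | i < t]].

Definition coefs_redpoly (F : finFieldType) (t : nat)
    (c : {ffun {ffun 'I_t -> 'I_#|F|.-1.+1} -> F}) : option (redpoly F t) :=
  insub (\sum_e c e *: 'X_[[multinom (e i : nat) | i < t]]).

Lemma redpoly_coefsK (F : finFieldType) (t : nat) :
  pcancel (@redpoly_coefs F t) (@coefs_redpoly F t).
Proof.
move=> p; rewrite /coefs_redpoly.
suff -> : \sum_e redpoly_coefs p e *: 'X_[[multinom (e i : nat) | i < t]]
          = val p by rewrite valK.
apply/mpolyP => m; rewrite raddf_sum /=.
have [mlt | mbig] := boolP [forall i, (m i <= #|F|.-1)%N].
  pose e0 : {ffun 'I_t -> 'I_#|F|.-1.+1} := [ffun i => inord (m i)].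
  have e0E : [multinom (e0 i : nat) | i < t] = m.
    apply/mnmP => i; rewrite mnmE ffunE inordK // ltnS.
    exact: (forallP mlt).
  rewrite (bigD1 e0) //= big1 ?addr0 => [|e ne].
    by rewrite mcoeffZ mcoeffX ffunE e0E eqxx mulr1.
  rewrite mcoeffZ mcoeffX; case: eqP => [em|_]; last by rewrite mulr0.
  case/eqP: ne; apply/ffunP => i; apply/val_inj.
  move/mnmP/(_ i): em; rewrite mnmE -e0E mnmE; exact.
rewrite big1 => [|e _].
  rewrite memN_msupp_eq0 //; apply: contra mbig => mp.
  exact: (allP (valP p)).
rewrite mcoeffZ mcoeffX; case: eqP => [em|_]; last by rewrite mulr0.
case/negP: mbig; apply/forallP => i.
by rewrite -em mnmE -ltnS.
Qed.

HB.instance Definition _ (F : finFieldType) (t : nat) :=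
  PCanIsCountable (@redpoly_coefsK F t).
HB.instance Definition _ (F : finFieldType) (t : nat) :
  isFinite (redpoly F t) :=
  PCanIsFinite (@redpoly_coefsK F t).

Definition zeros (F : finFieldType) (t : nat) (g : {mpoly F[t]}) :
    {set 'cV[F]_t} :=
  [set y : 'cV[F]_t | g.@[fun i => y i 0] == 0].

(* The inclusion  eqn_mx *m X \in eqn_rhs. *)
Record mrhs_eqn (F : finFieldType) (n : nat) : Type := MrhsEqn {
  eqn_rows : nat;
  eqn_mx : 'M[F]_(eqn_rows, n);
  eqn_rhs : {set 'cV[F]_eqn_rows}
}.

(* [maxrankfun B] selects \rank B linearly independent rows of B. *)
Definition glue_mx (F : finFieldType) (n t1 t2 : nat)
    (A1 : 'M[F]_(t1, n)) (A2 : 'M[F]_(t2, n)) :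
    'M[F]_(\rank (col_mx A1 A2), n) :=
  rowsub (maxrankfun (col_mx A1 A2)) (col_mx A1 A2).

(* Two linear systems are equivalent when they have the same solutions. *)
Definition glue_rhs (F : finFieldType) (n t1 t2 : nat)
    (A1 : 'M[F]_(t1, n)) (S1 : {set 'cV[F]_t1})
    (A2 : 'M[F]_(t2, n)) (S2 : {set 'cV[F]_t2}) :
    {set 'cV[F]_(\rank (col_mx A1 A2))} :=
  [set b | [exists b1 in S1, [exists b2 in S2, [forall X : 'cV[F]_n,
     (glue_mx A1 A2 *m X == b) == ((A1 *m X == b1) && (A2 *m X == b2))]]]].

Definition glue (F : finFieldType) (n : nat) (E1 E2 : mrhs_eqn F n) :
    mrhs_eqn F n :=
  MrhsEqn (glue_mx (eqn_mx E1) (eqn_mx E2))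
          (glue_rhs (eqn_mx E1) (eqn_rhs E1) (eqn_mx E2) (eqn_rhs E2)).

(* The equations obtained by gluing the first 1, 2, ..., m equations. *)
Definition gluings (F : finFieldType) (n : nat) (s : seq (mrhs_eqn F n)) :
    seq (mrhs_eqn F n) :=
  if s is E :: s' then E :: scanl (@glue F n) E s' else [::].

Definition sample (F : finFieldType) (m : nat) (ts : 'I_m -> nat) : finType :=
  {dffun forall i : 'I_m, redpoly F (ts i)}.

Definition mrhs_system (F : finFieldType) (n m : nat) (ts : 'I_m -> nat)
    (A : forall i : 'I_m, 'M[F]_(ts i, n)) (g : sample F ts) :
    seq (mrhs_eqn F n) :=
  [seq MrhsEqn (A i) (zeros (g i)) | i <- enum 'I_m].

(* |S^(k+1)|, for k < m. *)
Definition num_rhs (F : finFieldType) (n m : nat) (ts : 'I_m -> nat)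
    (A : forall i : 'I_m, 'M[F]_(ts i, n)) (k : 'I_m) (g : sample F ts) : nat :=
  nth 0%N [seq #|eqn_rhs E| | E <- gluings (mrhs_system A g)] k.

(* The g_i are independent and uniform: the law is the product one. *)
Definition expectation (F : finFieldType) (m : nat) (ts : 'I_m -> nat)
    (Y : sample F ts -> nat) : rat :=
  \sum_(g : sample F ts)
    (\prod_(i < m) (#|{: redpoly F (ts i)}|%:R)^-1) * (Y g)%:R.

Definition avg_complexity (F : finFieldType) (n m : nat) (ts : 'I_m -> nat)
    (A : forall i : 'I_m, 'M[F]_(ts i, n)) : rat :=
  \sum_(k < m) expectation (num_rhs A k).

(* Main.v *)
Require Import Defs.
From mathcomp Require Import all_boot all_order all_algebra.
From mathcomp Require Import zify.

(** Right-hand sides of a glued equation [A X \in S] correspond to the cosets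
    of [ker A] consisting of common solutions of the glued equations, so
    [#|S| * q ^ (n - \rank A)] is the number of these solutions.  A fixed [X]
    satisfies one random equation with probability [1 / q], because the
    constant term of a random polynomial is uniform; so the first [k] equations
    have [q ^ (n - k)] common solutions on average, and [E #|S^(k)|] is
    [q ^ (r - k)] with [r <= minn n (t * k)].  The exponent is largest around
    [k = n / t], whence the bound, with constant [1]. *)

Set Implicit Arguments.
Unset Strict Implicit.
Unset Printing Implicit Defensive.

Import Order.TTheory GRing.Theory Num.Theory.

Local Open Scope ring_scope.

Lemma reduced_addC (F : finFieldType) (t : nat) (p : {mpoly F[t]}) (c : F) :
  reduced p -> reduced (p + c%:MP).
Proof.
move=> /allP red_p; apply/allP => e /msuppD_le; rewrite mem_cat.
case/orP => [/red_p // |]; rewrite msuppC; case: eqP => // _.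
by rewrite inE => /eqP->; apply/forallP => i; rewrite mnm0E.
Qed.

(** If [p] vanishes at [y], then [p + c] takes the value [c] there, so the sum determines [c] and
    then [p]. *)
Lemma card_redpoly_zero (F : finFieldType) (t : nat) (y : 'cV[F]_t) :
  (#|F| * #|[pred p : redpoly F t | y \in zeros p]| <= #|{: redpoly F t}|)%N.
Proof.
set Z := [pred p : redpoly F t | y \in zeros p].
rewrite mulnC -cardsT -(cardsE Z) -cardsX.
pose f (u : redpoly F t * F) : redpoly F t :=
  RedPoly (reduced_addC u.2 (valP u.1)).
apply: (@leq_card_in _ _ f) => -[p c] [p' c'].
rewrite !inE /= => /andP[/eqP py _] /andP[/eqP p'y _] /(congr1 val) /= eq_pc.
have eq_c : c = c'.
  have := congr1 (meval (fun i => y i 0)) eq_pc.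
  by rewrite !mevalD !mevalC py p'y !add0r.
by move: eq_pc; rewrite eq_c => /addIr /val_inj->.
Qed.

Lemma card_sampleE (F : finFieldType) (m : nat) (ts : 'I_m -> nat) :
  #|{: sample F ts}| = (\prod_(i < m) #|{: redpoly F (ts i)}|)%N.
Proof. by rewrite card_dep_ffun foldrE big_map big_enum. Qed.

Lemma card_sample_zeros (F : finFieldType) (m : nat) (ts : 'I_m -> nat)
    (J : {pred 'I_m}) (y : forall i : 'I_m, 'cV[F]_(ts i)) :
  (#|F| ^ #|J| * #|[pred g : sample F ts | [forall i in J, y i \in zeros (g i)]]|
     <= #|{: sample F ts}|)%N.
Proof.
(* Outside [J] the predicate [Z i] holds everywhere, so the event is a product of the [Z i] and its
   cardinality factorises. *)
pose Z (i : 'I_m) : pred (redpoly F (ts i)) :=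
  [pred p : redpoly F (ts i) | (i \in J) ==> (y i \in zeros p)].
have -> : #|[pred g : sample F ts | [forall i in J, y i \in zeros (g i)]]|
    = (\prod_(i < m) #|Z i|)%N.
  rewrite -big_enum -(big_map (fun i => #|Z i|) predT id) -foldrE -card_family.
  by apply: eq_card => g; rewrite !inE.
rewrite card_sampleE -prod_nat_const big_mkcond -big_split /=.
apply: leq_prod => i _; case: ifP => Ji.
  apply: leq_trans (card_redpoly_zero (y i)); rewrite leq_mul2l; apply/orP; right.
  by apply/subset_leq_card/subsetP => p; rewrite !inE Ji.
by rewrite mul1n max_card.
Qed.

Definition satisfies (F : finFieldType) (n : nat) (X : 'cV[F]_n)
  (E : mrhs_eqn F n) : bool := eqn_mx E *m X \in eqn_rhs E.

(** The selected rows span the row space of [col_mx A1 A2], so both matrices have the same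
    kernel. *)
Lemma mul_glue_mx_eq (F : finFieldType) (n t1 t2 : nat)
    (A1 : 'M[F]_(t1, n)) (A2 : 'M[F]_(t2, n)) (X Y : 'cV[F]_n) :
  (glue_mx A1 A2 *m X == glue_mx A1 A2 *m Y)
  = (A1 *m X == A1 *m Y) && (A2 *m X == A2 *m Y).
Proof.
have col_mxP : (A1 *m X == A1 *m Y) && (A2 *m X == A2 *m Y)
    = (col_mx A1 A2 *m X == col_mx A1 A2 *m Y).
  by rewrite !mul_col_mx; apply/andP/eqP => [[/eqP-> /eqP->] | /eq_col_mx[-> ->]].
have transfer p1 p2 (B1 : 'M[F]_(p1, n)) (B2 : 'M[F]_(p2, n)) :
    (B1 <= B2)%MS -> B2 *m X = B2 *m Y -> B1 *m X = B1 *m Y.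
  by case/submxP => D ->; rewrite -!mulmxA => ->.
have eqAB := eq_maxrowsub (col_mx A1 A2).
rewrite col_mxP; apply/eqP/eqP; apply: transfer; rewrite /glue_mx eqAB //.
Qed.

Lemma row_free_glue_mx (F : finFieldType) (n t1 t2 : nat)
    (A1 : 'M[F]_(t1, n)) (A2 : 'M[F]_(t2, n)) :
  row_free (glue_mx A1 A2).
Proof. exact: maxrowsub_free. Qed.

Lemma satisfies_glue (F : finFieldType) (n : nat) (X : 'cV[F]_n)
    (E1 E2 : mrhs_eqn F n) :
  satisfies X (glue E1 E2) = satisfies X E1 && satisfies X E2.
Proof.
rewrite /satisfies inE; apply/exists_inP/andP => [|[S1X S2X]].
  case=> b1 Sb1 /exists_inP[b2 Sb2] /forallP /(_ X).
  by rewrite eqxx => /eqP/esym/andP[/eqP-> /eqP->].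
(* The values taken at [X] serve as right-hand sides; the equivalence of the two systems is then
   [mul_glue_mx_eq]. *)
exists (eqn_mx E1 *m X) => //; apply/exists_inP; exists (eqn_mx E2 *m X) => //.
by apply/forallP => Y; rewrite mul_glue_mx_eq.
Qed.

(** Invariants of successive gluing: freeness is what [card_rhs_leq] asks for, the row count bounds
    the rank, and the last clause identifies the solutions of [G]. *)
Lemma foldl_glueP (F : finFieldType) (n t : nat) (E : mrhs_eqn F n)
    (s : seq (mrhs_eqn F n)) :
  row_free (eqn_mx E) -> all (fun E' => eqn_rows E' <= t)%N s ->
  let G := foldl (@glue F n) E s in
  [/\ row_free (eqn_mx G), (eqn_rows G <= eqn_rows E + size s * t)%N
    & forall X, satisfies X G = all (satisfies X) (E :: s)].
Proof.
elim: s E => [|E' s IHs] E freeE /= => [_|/andP[rowsE' rows_s]].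
  by split=> // [|X]; rewrite ?addn0 ?andbT.
have free_glue : row_free (eqn_mx (glue E E')) := row_free_glue_mx _ _.
have [freeG rowsG satG] := IHs _ free_glue rows_s.
split=> // [|X]; last by rewrite satG /= satisfies_glue andbA.
apply: leq_trans rowsG _; rewrite mulSn addnA leq_add2r.
by apply: leq_trans (rank_leq_row _) _; rewrite leq_add2l.
Qed.

(* With [B] a right inverse of [A], the map
   [(X, b) |-> (X - B A X + B b, A X)] is injective. *)
Lemma card_rhs_leq (F : finFieldType) (n r : nat) (A : 'M[F]_(r, n))
    (S : {set 'cV[F]_r}) :
  row_free A -> (#|S| * #|F| ^ n <= #|[pred X | A *m X \in S]| * #|F| ^ r)%N.
Proof.
case/row_freeP => B AB1.
have -> : (#|F| ^ n = #|[set: 'cV[F]_n]|)%N by rewrite cardsT card_mx muln1.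
have -> : (#|F| ^ r = #|[set: 'cV[F]_r]|)%N by rewrite cardsT card_mx muln1.
rewrite -(cardsE [pred X | A *m X \in S]) mulnC -!cardsX.
pose f (u : 'cV[F]_n * 'cV[F]_r) := (u.1 - B *m (A *m u.1) + B *m u.2, A *m u.1).
have Af X b : A *m (f (X, b)).1 = b.
  by rewrite /= mulmxDr mulmxBr !(mulmxA A B) AB1 !mul1mx subrr add0r.
rewrite -(@card_in_imset _ _ f) => [|[X b] [X' b'] _ _ eq_f]; last first.
  have eq_b : b = b' by rewrite -(Af X b) eq_f Af.
  have eq_AX : A *m X = A *m X' := congr1 snd eq_f.
  by move: (congr1 fst eq_f); rewrite /= eq_AX eq_b => /addIr/addIr->.
apply/subset_leq_card/subsetP => _ /imsetP[[X b] /setXP[_ Sb] ->].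
apply/setXP; split; last exact: in_setT.
by move: (Af X b); rewrite !inE /= => ->.
Qed.

Section Expectation.

Variables (F : finFieldType) (n m t : nat) (ts : 'I_m -> nat).
Variable A : forall i : 'I_m, 'M[F]_(ts i, n).
Hypothesis rankA : forall i, \rank (A i) = ts i.
Hypothesis ts_le : forall i, (ts i <= t)%N.

Let solution (k : 'I_m) (g : sample F ts) (X : 'cV[F]_n) :=
  [forall i in [pred i : 'I_m | i <= k]%N, A i *m X \in zeros (g i)].

Lemma num_rhs_leq (k : 'I_m) (g : sample F ts) :
  (num_rhs A k g * #|F| ^ n
     <= #|[pred X | solution k g X]| * #|F| ^ minn n (k.+1 * t))%N.
Proof.
pose eqn i := MrhsEqn (A i) (zeros (g i)).
have lt_ks : (k < size (enum 'I_m))%N by rewrite size_enum_ord.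
rewrite /num_rhs /mrhs_system -/eqn.
case def_s: (enum 'I_m) lt_ks => [|i0 s] // le_ks.
rewrite (nth_map (eqn i0)) /= ?size_scanl ?size_map ?ltnS //.
(* Indices start at 0: entry [k] glues the first equation with the [k] following ones. *)
rewrite nth_cons_scanl ?size_map // -map_take.
have free0 : row_free (eqn_mx (eqn i0)) by rewrite /row_free rankA.
have rows_s : all (fun E => eqn_rows E <= t)%N (map eqn (take k s)).
  by rewrite all_map; apply/allP => i _ /=.
have [] := foldl_glueP free0 rows_s; set G := foldl _ _ _ => freeG rowsG satG.
apply: leq_trans (card_rhs_leq _ freeG) _; apply: leq_mul.
  apply/subset_leq_card/subsetP => X; rewrite !inE -/(satisfies X G) satG.
  rewrite -[eqn i0 :: _]/(map eqn (take k.+1 (i0 :: s))) -def_s all_map => /allP sat.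
  apply/forall_inP => i le_ik; apply: (sat i).
  by rewrite in_take ?mem_enum // index_enum_ord.
(* Being free, the matrix of [G] has as many rows as its rank, hence at most [n]; the other bound
   allows [t] rows for each of [k.+1] equations. *)
rewrite leq_exp2l ?card_finNzRing_gt1 // leq_min -{1}(eqP freeG) rank_leq_col /=.
apply: leq_trans rowsG _; rewrite size_map size_take_min mulSn leq_add //=.
by rewrite leq_mul2r geq_minl orbT.
Qed.

(** Double counting of the pairs [(g, X)] with [X] a solution of the first [k.+1] equations: each of
    the [q ^ n] vectors [X] is one for at most a fraction [1 / q ^ k.+1] of the samples. This
    [q ^ n] cancels the one in [num_rhs_leq]. *)
Lemma sum_num_rhs_leq (k : 'I_m) :
  (#|F| ^ k.+1 * \sum_(g : sample F ts) num_rhs A k g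
     <= #|F| ^ minn n (k.+1 * t) * #|{: sample F ts}|)%N.
Proof.
set R := minn n (k.+1 * t).
have q_gt0 e : (0 < #|F| ^ e)%N by rewrite expn_gt0 ltnW ?card_finNzRing_gt1.
rewrite -(leq_pmul2r (q_gt0 n)) -mulnA big_distrl /=.
have sum_le : (\sum_(g : sample F ts) num_rhs A k g * #|F| ^ n <=
    (\sum_(X : 'cV[F]_n) #|[pred g | solution k g X]|) * #|F| ^ R)%N.
  have -> : (\sum_(X : 'cV[F]_n) #|[pred g | solution k g X]|
      = \sum_(g : sample F ts) #|[pred X | solution k g X]|)%N.
    transitivity (\sum_(X : 'cV[F]_n) \sum_(g : sample F ts) solution k g X)%N.
      by apply: eq_bigr => X _; rewrite -sum1_card big_mkcond.
    rewrite exchange_big; apply: eq_bigr => g _ /=.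
    by rewrite -sum1_card [RHS]big_mkcond.
  by rewrite big_distrl; apply: leq_sum => g _; apply: num_rhs_leq.
apply: leq_trans (leq_mul (leqnn _) sum_le) _.
rewrite mulnA mulnC -mulnA leq_mul2l big_distrr /=; apply/orP; right.
have -> : (#|{: sample F ts}| * #|F| ^ n
    = \sum_(X : 'cV[F]_n) #|{: sample F ts}|)%N.
  by rewrite sum_nat_const card_mx muln1 mulnC.
apply: leq_sum => X _.
have cardJ : #|[pred i : 'I_m | i <= k]%N| = k.+1.
  rewrite -sum1_card (eq_bigl (fun i : 'I_m => i < k.+1)%N) //.
  by rewrite (big_ord_narrow (ltn_ord k)) sum1_card card_ord.
rewrite -[in X in (X <= _)%N]cardJ.
exact: (card_sample_zeros [pred i : 'I_m | i <= k]%N (fun i => A i *m X)).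
Qed.

(** The uniform weights multiply to the inverse of the number of samples. The exponent is an integer
    because [k.+1] may exceed [n]. *)
Lemma expectation_num_rhs (k : 'I_m) :
  expectation (num_rhs A k)
    <= (#|F|%:R : rat) ^ ((minn n (k.+1 * t))%:Z - k.+1%:Z).
Proof.
have q_gt0 : (0 : rat) < #|F|%:R by rewrite ltr0n ltnW ?card_finNzRing_gt1.
have s_gt0 : (0 : rat) < #|{: sample F ts}|%:R.
  rewrite ltr0n card_sampleE prodn_cond_gt0 // => i _.
  have red0 : reduced (0 : {mpoly F[ts i]}) by rewrite /reduced msupp0.
  by apply/card_gt0P; exists (RedPoly red0).
rewrite /expectation -big_distrr /= prodfV -natr_prod -card_sampleE -natr_sum.
rewrite mulrC ler_pdivrMr // expfzDr ?lt0r_neq0 // -exprnN -exprnP.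
rewrite mulrAC ler_pdivlMr ?exprn_gt0 // -!natrX -!natrM ler_nat mulnC.
exact: sum_num_rhs_leq.
Qed.

End Expectation.

Lemma exponent_leq (n t k : nat) : (0 < t)%N ->
  (minn n (k.+1 * t))%:Z - k.+1%:Z <= n%:Z - Num.ceil (n%:R / t%:R : rat).
Proof.
move=> t_gt0; set R := minn _ _.
(* The truncated subtraction is exact since [R <= n]. *)
suff : Num.ceil (n%:R / t%:R : rat) <= (n - R + k.+1)%N%:Z.
  have : (R <= n)%N by rewrite geq_minl.
  by lia.
rewrite ceil_le_int ler_pdivrMr ?ltr0n // -pmulrn -natrM ler_nat.
(* With [K = k.+1], the goal is [n <= (n - R + K) * t]. If [R = n], this is [n <= K * t]; if
   [R = K * t], it follows from [n - R <= (n - R) * t], as [t >= 1]. *)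
by rewrite /R; case: leqP; nia.
Qed.

Theorem theorem3 (t : nat) (t_gt0 : (0 < t)%N) :
  exists C : rat, 0 < C /\
  exists N : nat,
  forall (n : nat), (N <= n)%N ->
  forall (F : finFieldType) (m : nat) (ts : 'I_m -> nat)
    (A : forall i : 'I_m, 'M[F]_(ts i, n)),
    (forall i : 'I_m, \rank (A i) = ts i) ->
    (forall i : 'I_m, (ts i <= t)%N) ->
    avg_complexity A <=
      C * (m%:R * (#|F|%:R : rat) ^ (n%:Z - Num.ceil (n%:R / t%:R : rat))).
Proof.
exists 1; split=> //; exists 0%N => n _ F m ts A rankA ts_le.
(* The factor [m] becomes a sum of [m] equal terms, so that the bounds compare termwise. *)
rewrite mul1r mulr_natl -[X in _ *+ X]card_ord -sumr_const.
apply: ler_sum => k _; apply: le_trans (expectation_num_rhs rankA ts_le k) _.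
by apply: ler_weXz2l; [rewrite ler1n ltnW ?card_finNzRing_gt1 | apply: exponent_leq].
Qed.
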